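(* For every injective endomorphism $\varepsilon$ of the semigroup $\boldsymbol{B}_{\omega}^{\mathscr{F}^4}$ there exist a non-negative integer $k$ and $l\in\{0,1\}$ such that $\varepsilon=\lambda^k\varpi_4^l$.
   Context: $\omega$ denotes the set of all non-negative integers, and for $a\in\omega$ put $[a)=\{x\in\omega\colon x\geqslant a\}$. For an integer $n$ and a set $F\subseteq\omega$ put $n+F=\{n+k\colon k\in F\}$ (a subset of $\mathbb{Z}$). The family $\mathscr{F}^4=\{[0),[1),[2),[3)\}$. The semigroup $\boldsymbol{B}_{\omega}^{\mathscr{F}^4}$ is the set $\omega\times\omega\times\mathscr{F}^4$ of triples $(i,j,F)$ with the operation $$(i_1,j_1,F_1)\cdot(i_2,j_2,F_2)=\begin{cases}(i_1-j_1+i_2,\,j_2,\,(j_1-i_2+F_1)\cap F_2), & \text{if } j_1\leqslant i_2;\\ (i_1,\,j_1-i_2+j_2,\,F_1\cap(i_2-j_1+F_2)), & \text{if } j_1\geqslant i_2.\end{cases}$$ An endomorphism of a semigroup $S$ is a homomorphism $S\to S$ (not necessarily preserving an identity element). Maps are written on the right of their arguments: $(x)\mathfrak{f}$ is the image of $x$ under $\mathfrak{f}$, and the product of maps is composition, from left to right. The maps $\lambda,\varpi_4\colon\boldsymbol{B}_{\omega}^{\mathscr{F}^4}\to\boldsymbol{B}_{\omega}^{\mathscr{F}^4}$ are defined by $$(i,j,[p))\lambda=(i+1,j+1,[p)),\qquad (i,j,[p))\varpi_4=(i+p,j+p,[3-p)),\qquad i,j\in\omega,\ p\in\{0,1,2,3\},$$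 and $\lambda^0$ and $\varpi_4^0$ are the identity map of $\boldsymbol{B}_{\omega}^{\mathscr{F}^4}$. *)

(* Defs.v *)
From HB Require Import structures.
From mathcomp Require Import all_boot all_order all_algebra.
From mathcomp Require Import zify.
From mathcomp Require Import boolp classical_sets.

Set Implicit Arguments.
Unset Strict Implicit.
Unset Printing Implicit Defensive.

Import Order.TTheory GRing.Theory Num.Theory.
Local Open Scope classical_set_scope.

(* Subsets of omega are viewed inside the integers, so that the translates
   n + F with n negative make sense; [ray a] is the set [a). *)
Definition ray (a : nat) : set int := [set x : int | (a%:Z <= x)%R].

Definition shift (n : int) (F : set int) : set int := [set (n + k)%R | k in F].

Definition F4 : set (set int) := [set ray 0; ray 1; ray 2; ray 3].

Lemma F4_ray (p : nat) : p < 4 -> F4 (ray p).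
Proof. by case: p => [|[|[|[|]]]] //= _; rewrite /F4 /=; tauto. Qed.

Lemma F4P (F : set int) : F4 F <-> exists2 p : nat, p < 4 & F = ray p.
Proof.
split; last by case=> p p4 ->; exact: F4_ray.
case; first case; first case; move=> ->.
- by exists 0.
- by exists 1.
- by exists 2.
- by exists 3.
Qed.

Lemma ray_inj : injective ray.
Proof.
move=> a b E.
have h1 : ray b a by rewrite -E /ray /=; lia.
have h2 : ray a b by rewrite E /ray /=; lia.
by move: h1 h2; rewrite /ray /=; lia.
Qed.

Lemma shift_ray (a d p q : nat) : a <= d ->
  shift (a%:Z - d%:Z)%R (ray p) `&` ray q = ray (maxn (p - (d - a)) q).
Proof.
move=> ad; apply/seteqP; split=> x.
  by case=> -[k]; rewrite /ray /= => h1 <- h2; lia.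
rewrite /ray /= => h; split; last by lia.
by exists (x + d%:Z - a%:Z)%R => /=; lia.
Qed.

Lemma F4_mull (a d : nat) (F1 F2 : set int) : F4 F1 -> F4 F2 -> a <= d ->
  F4 (shift (a%:Z - d%:Z)%R F1 `&` F2).
Proof.
move=> /F4P[p p4 ->] /F4P[q q4 ->] ad; rewrite shift_ray //.
by apply: F4_ray; lia.
Qed.

Record B4 := MkB4 {
  b4i : nat;
  b4j : nat;
  b4F : set int;
  b4F_in : F4 b4F }.

Lemma B4_eq (x y : B4) :
  b4i x = b4i y -> b4j x = b4j y -> b4F x = b4F y -> x = y.
Proof.
case: x y => [i j F Fi] [i' j' F' Fi'] /= -> -> E.
by case: _ / E Fi' => Fi'; rewrite (Prop_irrelevance Fi Fi').
Qed.

HB.instance Definition _ := gen_eqMixin B4.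
HB.instance Definition _ := gen_choiceMixin B4.

(* The subtractions on nat never truncate; the two cases of the product agree
   when b4j x = b4i y (see [b4mul_ge]). *)
Definition b4mul_triple (x y : B4) : nat * nat * set int :=
  if b4j x <= b4i y
  then (b4i x + b4i y - b4j x, b4j y,
        shift ((b4j x)%:Z - (b4i y)%:Z)%R (b4F x) `&` b4F y)
  else (b4i x, b4j x + b4j y - b4i y,
        b4F x `&` shift ((b4i y)%:Z - (b4j x)%:Z)%R (b4F y)).

Lemma b4mul_triple_in (x y : B4) : F4 (b4mul_triple x y).2.
Proof.
case: x y => [i j F HF] [i' j' F' HF']; rewrite /b4mul_triple /=.
case: leqP => h; first exact: F4_mull.
by rewrite setIC; apply: F4_mull => //; exact: ltnW.
Qed.

Definition b4mul (x y : B4) : B4 :=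
  MkB4 (b4mul_triple x y).1.1 (b4mul_triple x y).1.2 (b4mul_triple_in x y).

Lemma b4mul_le (x y : B4) : b4j x <= b4i y ->
  [/\ b4i (b4mul x y) = b4i x + b4i y - b4j x,
      b4j (b4mul x y) = b4j y &
      b4F (b4mul x y) =
        shift ((b4j x)%:Z - (b4i y)%:Z)%R (b4F x) `&` b4F y].
Proof. by move=> h; rewrite /= /b4mul_triple h. Qed.

Lemma b4mul_ge (x y : B4) : b4i y <= b4j x ->
  [/\ b4i (b4mul x y) = b4i x,
      b4j (b4mul x y) = b4j x + b4j y - b4i y &
      b4F (b4mul x y) =
        b4F x `&` shift ((b4i y)%:Z - (b4j x)%:Z)%R (b4F y)].
Proof.
move=> h; rewrite /= /b4mul_triple; case: leqP => h' //=.
have e : b4j x = b4i y by lia.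
have s0 F : shift 0 F = F.
  apply/seteqP; split=> z; first by case=> k Fk <-; rewrite add0r.
  by move=> Fz; exists z => //; rewrite add0r.
by rewrite e subrr !s0; split=> //; lia.
Qed.

Definition b4tri (i j : nat) (p : 'I_4) : B4 := MkB4 i j (F4_ray (ltn_ord p)).

Lemma b4triP (x : B4) : exists i j p, x = b4tri i j p.
Proof.
case: x => i j F HF; have /F4P[p p4 E] := HF.
by exists i, j, (Ordinal p4); apply: B4_eq.
Qed.

Lemma maxn_subl (a b c : nat) : maxn a b - c = maxn (a - c) (b - c).
Proof. lia. Qed.

Lemma b4mul_ray (x y : B4) (p q : nat) : b4F x = ray p -> b4F y = ray q ->
  b4F (b4mul x y) =
    ray (maxn (p - (b4i y - b4j x)) (q - (b4j x - b4i y))).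
Proof.
move=> Ep Eq; case: (leqP (b4j x) (b4i y)) => h.
  have [_ _ ->] := b4mul_le h; rewrite Ep Eq shift_ray //.
  by congr ray; lia.
have [_ _ ->] := b4mul_ge (ltnW h); rewrite Ep Eq setIC (shift_ray _ _ (ltnW h)).
by congr ray; lia.
Qed.

Lemma b4mul_ij (x y : B4) :
  b4i (b4mul x y) = b4i x + (b4i y - b4j x) /\
  b4j (b4mul x y) = b4j y + (b4j x - b4i y).
Proof.
case: (leqP (b4j x) (b4i y)) => h.
  by have [-> -> _] := b4mul_le h; lia.
by have [-> -> _] := b4mul_ge (ltnW h); lia.
Qed.

Lemma b4mulA : associative b4mul.
Proof.
move=> x y z.
have [p _ Ex] := (F4P _).1 (b4F_in x).
have [q _ Ey] := (F4P _).1 (b4F_in y).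
have [r _ Ez] := (F4P _).1 (b4F_in z).
have [a1 a2] := b4mul_ij x y; have [c1 c2] := b4mul_ij y z.
have [d1 d2] := b4mul_ij (b4mul x y) z.
have [e1 e2] := b4mul_ij x (b4mul y z).
apply: B4_eq; first by rewrite e1 d1 a1 a2 c1; lia.
  by rewrite e2 d2 a2 c1 c2; lia.
rewrite (b4mul_ray Ex (b4mul_ray Ey Ez)) (b4mul_ray (b4mul_ray Ex Ey) Ez).
rewrite a2 c1; congr ray; rewrite !maxn_subl -!maxnA.
move: (b4j x) (b4i y) (b4j y) (b4i z) => a b c d; clear.
by rewrite -!subnDA; congr maxn; [|congr maxn]; (congr subn; lia).
Qed.

HB.instance Definition _ := isSemigroup.Build B4 b4mulA.

Definition lambda4 (x : B4) : B4 := MkB4 (b4i x).+1 (b4j x).+1 (b4F_in x).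

(* The p in {0, 1, 2, 3} with F = [p); it is unique by [ray_inj]. *)
Definition rayidx (F : set int) : 'I_4 := xget ord0 [set p : 'I_4 | F = ray p].

Lemma rayidx_ray (p : 'I_4) : rayidx (ray p) = p.
Proof.
rewrite /rayidx; case: xgetP => [q _ /ray_inj /val_inj -> //|/(_ p)].
by case.
Qed.

Definition varpi4 (x : B4) : B4 :=
  let p := rayidx (b4F x) in b4tri (b4i x + p) (b4j x + p) (rev_ord p).

Lemma lambda4E (i j : nat) (p : 'I_4) :
  lambda4 (b4tri i j p) = b4tri i.+1 j.+1 p.
Proof. by []. Qed.

Lemma varpi4E (i j : nat) (p : 'I_4) :
  varpi4 (b4tri i j p) = b4tri (i + p) (j + p) (rev_ord p).
Proof. by rewrite /varpi4 /= rayidx_ray. Qed.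

Lemma b4F_varpi4 (i j : nat) (p : 'I_4) :
  b4F (varpi4 (b4tri i j p)) = ray (3 - p).
Proof. by rewrite varpi4E. Qed.

(* Main.v *)
(** Record [(i, j, [p))] by the two pairs [(i, j)] and [(i + p, j + p)]: the
    semigroup becomes a subsemigroup of the square of the bicyclic monoid.
    Its idempotents are the pairs [(a, b)] with [a <= b <= a + 3] under the
    componentwise maximum, and the elements with a fixed [p] form a bicyclic
    monoid.  An injective endomorphism restricts on the [p]-th copy to
    [(i, j, [p)) |-> (c p + d i, c p + d j, [s p))] with [d > 0]; the difference
    [j - i] being additive, [d] does not depend on [p].  The joins of
    incomparable idempotents then force [d = 1] and either [s p = p] with [c]
    constant, or [s p = 3 - p] with [c p = c 0 + p]. *)
Require Import Defs.
From mathcomp Require Import all_boot.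
From mathcomp Require Import zify.

Set Implicit Arguments.
Unset Strict Implicit.
Unset Printing Implicit Defensive.

Definition b4p (x : B4) : 'I_4 := rayidx (b4F x).

Lemma b4p_tri (i j : nat) (p : 'I_4) : b4p (b4tri i j p) = p.
Proof. exact: rayidx_ray. Qed.

Lemma b4F_b4p (x : B4) : b4F x = ray (b4p x).
Proof. by have [i [j [p ->]]] := b4triP x; rewrite b4p_tri. Qed.

Lemma b4tri_eta (x : B4) : b4tri (b4i x) (b4j x) (b4p x) = x.
Proof. by apply: B4_eq; rewrite //= -b4F_b4p. Qed.

Lemma b4p_mul (x y : B4) :
  b4p (b4mul x y) = maxn (b4p x - (b4i y - b4j x)) (b4p y - (b4j x - b4i y))
    :> nat.
Proof.
by have := b4mul_ray (b4F_b4p x) (b4F_b4p y); rewrite b4F_b4p => /ray_inj.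
Qed.

Lemma b4mul_tri (i j k l m n : nat) (p q r : 'I_4) :
    m = i + (k - j) -> n = l + (j - k) ->
    r = maxn (p - (k - j)) (q - (j - k)) :> nat ->
  b4mul (b4tri i j p) (b4tri k l q) = b4tri m n r.
Proof.
move=> -> -> Er; have [Ei Ej] := b4mul_ij (b4tri i j p) (b4tri k l q).
rewrite -[LHS]b4tri_eta Ei Ej; congr b4tri; apply: val_inj => /=.
by rewrite b4p_mul !b4p_tri Er.
Qed.

(* [(c, s)] stands for the idempotent [(c, c, [s))], that is, for the pair
   [(c, c + s)]; the third one is the join of two incomparable ones. *)
Lemma join_cases (c1 s1 c2 s2 c3 s3 : nat) :
    c3 = maxn c1 c2 -> c3 + s3 = maxn (c1 + s1) (c2 + s2) ->
    (c1 != c3) || (s1 != s3) -> (c2 != c3) || (s2 != s3) ->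
  [/\ c1 < c2, c3 = c2, c2 + s2 < c1 + s1 & c3 + s3 = c1 + s1] \/
  [/\ c2 < c1, c3 = c1, c1 + s1 < c2 + s2 & c3 + s3 = c2 + s2].
Proof.
by move=> *; case: (ltngtP c1 c2) => ?; [left|right|exfalso]; try split; lia.
Qed.

(* The disjunctions are [join_cases] for the images of [(0, 0, [2))] and of
   [(0, 0, [3))] joined with that of [(1, 1, [0))]. *)
Lemma rigid_arith (d c0 c1 c2 c3 s0 s1 s2 s3 : nat) :
    0 < d -> s0 < 4 -> s1 < 4 -> s2 < 4 -> s3 < 4 ->
    c1 = maxn c0 c1 -> c1 + s1 = maxn (c0 + s0) (c1 + s1) ->
    (c0 != c1) || (s0 != s1) ->
    c3 = maxn c2 c3 -> c3 + s3 = maxn (c2 + s2) (c3 + s3) ->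
    (c2 != c3) || (s2 != s3) ->
    [/\ c2 < c0 + d, c1 + d = c0 + d, c0 + d + s0 < c2 + s2 &
        c1 + d + s1 = c2 + s2] \/
    [/\ c0 + d < c2, c1 + d = c2, c2 + s2 < c0 + d + s0 &
        c1 + d + s1 = c0 + d + s0] ->
    [/\ c3 < c0 + d, c2 + d = c0 + d, c0 + d + s0 < c3 + s3 &
        c2 + d + s2 = c3 + s3] \/
    [/\ c0 + d < c3, c2 + d = c3, c3 + s3 < c0 + d + s0 &
        c2 + d + s2 = c0 + d + s0] ->
  d = 1 /\
  ([/\ c1 = c0, c2 = c0 & c3 = c0] /\ [/\ s0 = 0, s1 = 1, s2 = 2 & s3 = 3] \/
   [/\ c1 = c0 + 1, c2 = c0 + 2 & c3 = c0 + 3] /\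
   [/\ s0 = 3, s1 = 2, s2 = 1 & s3 = 0]).
Proof.
move=> d0 l0 l1 l2 l3 h1 h2 h3 h4 h5 h6.
case=> -[a1 a2 a3 a4] -[] [b1 b2 b3 b4]; try (exfalso; lia).
  (* Here [s0 < s1 < s2 < s3 < 4], so these are 0, 1, 2, 3, and [s2 = s1 + d]. In the case left
     below, the chain is strictly decreasing and [s1 = s2 + d]. *)
  have d1 : d = 1 by lia.
  by subst d; split=> //; left; split; split; lia.
have d1 : d = 1 by lia.
by subst d; split=> //; right; split; split; lia.
Qed.

Section InjectiveEndomorphism.

Variables (eps : B4 -> B4) (epsM : {morph eps : x y / b4mul x y}).
Hypothesis eps_inj : injective eps.

Let c (p : 'I_4) : nat := b4i (eps (b4tri 0 0 p)).
Let d (p : 'I_4) : nat := b4j (eps (b4tri 0 1 p)) - c p.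
Let s (p : 'I_4) : 'I_4 := b4p (eps (b4tri 0 0 p)).

(** Write [e], [a], [b] for the three images. The bicyclic relations [ee = e], [ea = a], [be = b],
    [ab = e], read in coordinates, leave only this shape; injectivity makes [d p] positive, so its
    subtraction does not truncate. *)
Lemma endo_gen (p : 'I_4) :
  [/\ eps (b4tri 0 0 p) = b4tri (c p) (c p) (s p),
      eps (b4tri 0 1 p) = b4tri (c p) (c p + d p) (s p),
      eps (b4tri 1 0 p) = b4tri (c p + d p) (c p) (s p) &
      0 < d p].
Proof.
have Ee : b4mul (eps (b4tri 0 0 p)) (eps (b4tri 0 0 p)) = eps (b4tri 0 0 p).
  by rewrite -epsM; congr eps; apply: b4mul_tri => //; lia.
have Ea : b4mul (eps (b4tri 0 0 p)) (eps (b4tri 0 1 p)) = eps (b4tri 0 1 p).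
  by rewrite -epsM; congr eps; apply: b4mul_tri => //; lia.
have Eb : b4mul (eps (b4tri 1 0 p)) (eps (b4tri 0 0 p)) = eps (b4tri 1 0 p).
  by rewrite -epsM; congr eps; apply: b4mul_tri => //; lia.
have Eab : b4mul (eps (b4tri 0 1 p)) (eps (b4tri 1 0 p)) = eps (b4tri 0 0 p).
  by rewrite -epsM; congr eps; apply: b4mul_tri => //; lia.
have Eba : b4mul (eps (b4tri 1 0 p)) (eps (b4tri 0 1 p)) = eps (b4tri 1 1 p).
  by rewrite -epsM; congr eps; apply: b4mul_tri => //; lia.
have Ef : b4mul (eps (b4tri 0 0 p)) (eps (b4tri 1 1 p)) = eps (b4tri 1 1 p).
  by rewrite -epsM; congr eps; apply: b4mul_tri => //; lia.
have ne : eps (b4tri 0 1 p) <> eps (b4tri 0 0 p).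
  by move/eps_inj => /(congr1 b4j).
rewrite /d /c /s; move: ne Ee Ea Eb Eab Eba Ef.
move: (eps (b4tri 0 0 p)) (eps (b4tri 0 1 p)) (eps (b4tri 1 0 p))
  (eps (b4tri 1 1 p)) => e a b f ne Ee Ea Eb Eab Eba Ef.
have coord x y z : b4mul x y = z ->
    [/\ b4i z = b4i x + (b4i y - b4j x), b4j z = b4j y + (b4j x - b4i y) &
        b4p z = maxn (b4p x - (b4i y - b4j x)) (b4p y - (b4j x - b4i y))
          :> nat].
  by move=> <-; have [-> ->] := b4mul_ij x y; rewrite b4p_mul.
have [e1 e2 e3] := coord _ _ _ Ee; have [a1 a2 a3] := coord _ _ _ Ea.
have [b1 b2 b3] := coord _ _ _ Eb; have [ab1 ab2 ab3] := coord _ _ _ Eab.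
have [ba1 ba2 ba3] := coord _ _ _ Eba; have [f1 f2 f3] := coord _ _ _ Ef.
have eij : b4j e = b4i e by move: e1 e2; clear; lia.
have ai : b4i a = b4i e by move: a1 ab1 eij; clear; lia.
have bj : b4j b = b4i e by move: b2 ab2 eij; clear; lia.
have ij : b4i b = b4j a by move: ab1 ab2 eij ai bj; clear; lia.
(* [ea = a] gives [b4p e <= b4p a]; [ab = e] with [b4i b = b4j a] gives the reverse. *)
have pa : b4p a = b4p e.
  by apply: val_inj; move: a3 ab3; rewrite ai eij ij /=; clear; lia.
have pb : b4p b = b4p e.
  by apply: val_inj; move: b3 ab3; rewrite bj ij /=; clear; lia.
(* The first coordinate of [f = ba] is [b4j a], and [ef = f] makes it at least [b4i e]; equality
   would give [a = e]. *)
have lt : b4i e < b4j a.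
  suff : b4j a != b4i e by move: ba1 ba2 f1 f2 ai bj ij eij; clear; lia.
  apply/eqP => ja; apply: ne; rewrite -(b4tri_eta a) -(b4tri_eta e) pa.
  by rewrite ai ja eij.
split; rewrite -?pa -?pb; last by rewrite subn_gt0.
- by rewrite -[LHS]b4tri_eta pa eij.
- by rewrite -[LHS]b4tri_eta ai subnKC // ltnW.
- by rewrite -[LHS]b4tri_eta bj ij pa pb subnKC // ltnW.
Qed.

Lemma endo_tri (i j : nat) (p : 'I_4) :
  eps (b4tri i j p) = b4tri (c p + d p * i) (c p + d p * j) (s p).
Proof.
have [E Ea Eb _] := endo_gen p.
elim: i j => [|i IH] j.
  elim: j => [|j IH]; first by rewrite E; congr b4tri; lia.
  have -> : b4tri 0 j.+1 p = b4mul (b4tri 0 j p) (b4tri 0 1 p).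
    by symmetry; apply: b4mul_tri => //; lia.
  by rewrite epsM IH Ea; apply: b4mul_tri; lia.
have -> : b4tri i.+1 j p = b4mul (b4tri 1 0 p) (b4tri i j p).
  by symmetry; apply: b4mul_tri => //; lia.
by rewrite epsM IH Eb; apply: b4mul_tri; lia.
Qed.

(** Left multiplication by an idempotent moves [(0, 1, [p))] to the [q]-th copy and keeps the
    difference [j - i], which is [d] on the images. *)
Lemma endo_step (p q : 'I_4) : p <= q -> d p = d q.
Proof.
move=> pq; have : b4mul (b4tri 0 0 q) (b4tri 0 1 p) = b4tri 0 1 q.
  by apply: b4mul_tri => //; lia.
move=> /(congr1 eps); rewrite epsM !endo_tri => E.
move: (b4mul_ij (b4tri (c q + d q * 0) (c q + d q * 0) (s q))
  (b4tri (c p + d p * 0) (c p + d p * 1) (s p))).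
by rewrite E /= => -[]; lia.
Qed.

(** Idempotents multiply as joins of the pairs [(m, m + r)], and [eps] preserves these joins. *)
Lemma endo_join (k l m : nat) (p q r : 'I_4) :
    m = maxn k l -> m + r = maxn (k + p) (l + q) ->
  c r + d r * m = maxn (c p + d p * k) (c q + d q * l) /\
  c r + d r * m + s r = maxn (c p + d p * k + s p) (c q + d q * l + s q).
Proof.
move=> Em Er; have : b4mul (b4tri k k p) (b4tri l l q) = b4tri m m r.
  by apply: b4mul_tri; lia.
move=> /(congr1 eps); rewrite epsM !endo_tri.
set x := b4tri _ _ (s p); set y := b4tri _ _ (s q) => E.
have [] := b4mul_ij x y; have := b4p_mul x y.
by rewrite E !b4p_tri /= => h1 h2 _; lia.
Qed.

Lemma endo_neq (k l : nat) (p q : 'I_4) : (k, val p) != (l, val q) ->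
  (c p + d p * k != c q + d q * l) || (s p != s q :> nat).
Proof.
apply: contraNT; rewrite negb_or !negbK => /andP[/eqP h1 /eqP/val_inj h2].
have /eps_inj E : eps (b4tri k k p) = eps (b4tri l l q).
  by rewrite !endo_tri h1 h2.
by have /= -> := congr1 b4i E; have := congr1 b4p E; rewrite !b4p_tri => ->.
Qed.

Lemma endo_rigid :
  (forall p, [/\ d p = 1, c p = c ord0 & s p = p]) \/
  (forall p, [/\ d p = 1, c p = c ord0 + p & s p = rev_ord p]).
Proof.
pose o1 : 'I_4 := @Ordinal 4 1 isT; pose o2 : 'I_4 := @Ordinal 4 2 isT.
pose o3 : 'I_4 := @Ordinal 4 3 isT.
have [_ _ _ dpos] := endo_gen ord0.
have e1 : d o1 = d ord0 by rewrite (@endo_step ord0 o1).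
have e2 : d o2 = d ord0 by rewrite (@endo_step ord0 o2).
have e3 : d o3 = d ord0 by rewrite (@endo_step ord0 o3).
have [j1 j1'] := @endo_join 0 0 0 ord0 o1 o1 erefl erefl.
have [j3 j3'] := @endo_join 0 0 0 o2 o3 o3 erefl erefl.
(* In pairs: [(0, 2)] and [(1, 1)] have join [(1, 2)]; [(0, 3)] and [(1, 1)] have join [(1, 3)]. *)
have [k1 k1'] := @endo_join 0 1 1 o2 ord0 o1 erefl erefl.
have [k2 k2'] := @endo_join 0 1 1 o3 ord0 o2 erefl erefl.
have n1 := @endo_neq 0 0 ord0 o1 isT; have n3 := @endo_neq 0 0 o2 o3 isT.
have i1 := join_cases k1 k1' (@endo_neq 0 1 o2 o1 isT)
  (@endo_neq 1 1 ord0 o1 isT).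
have i2 := join_cases k2 k2' (@endo_neq 0 1 o3 o2 isT)
  (@endo_neq 1 1 ord0 o2 isT).
rewrite e1 e2 e3 !muln0 !muln1 !addn0 in j1 j1' j3 j3' n1 n3 i1 i2.
have [d1 H] := rigid_arith dpos (ltn_ord _) (ltn_ord _) (ltn_ord _)
  (ltn_ord _) j1 j1' n1 j3 j3' n3 i1 i2.
have all4 (P : 'I_4 -> Prop) : P ord0 -> P o1 -> P o2 -> P o3 -> forall p, P p.
  move=> P0 P1 P2 P3 [[|[|[|[|//]]]] lt].
  - by rewrite (_ : Ordinal lt = ord0) //; apply: val_inj.
  - by rewrite (_ : Ordinal lt = o1) //; apply: val_inj.
  - by rewrite (_ : Ordinal lt = o2) //; apply: val_inj.
  - by rewrite (_ : Ordinal lt = o3) //; apply: val_inj.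
case: H => -[[h2 h3 h4] [g0 g1 g2 g3]]; [left | right].
  by apply: all4; split; rewrite ?e1 ?e2 ?e3 //; apply: val_inj.
by apply: all4; split; rewrite ?e1 ?e2 ?e3 ?addn0 //; apply: val_inj.
Qed.

End InjectiveEndomorphism.

Lemma iter_lambda4 (k i j : nat) (p : 'I_4) :
  iter k lambda4 (b4tri i j p) = b4tri (k + i) (k + j) p.
Proof. by elim: k => //= k ->. Qed.

Theorem theorem3p2 (eps : {multiplicative B4 -> B4}) (eps_inj : injective eps) :
  exists k l : nat,
    (l = 0 \/ l = 1) /\ eps =1 (iter l varpi4 \o iter k lambda4).
Proof.
have epsM : {morph eps : x y / b4mul x y} by move=> x y; exact: gmulfM.
(* [varpi4] does not move the coordinates [i], [j] when [p = 0], so this image shows the exponent of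
   [lambda4] for either [l]. *)
exists (b4i (eps (b4tri 0 0 ord0))).
have [H|H] := endo_rigid epsM eps_inj.
  exists 0; split; first by left.
  move=> x; have [i [j [p ->]]] := b4triP x.
  rewrite (endo_tri epsM eps_inj) /= iter_lambda4.
  by have [-> -> ->] := H p; rewrite !mul1n.
exists 1; split; first by right.
move=> x; have [i [j [p ->]]] := b4triP x.
rewrite (endo_tri epsM eps_inj) /= iter_lambda4 varpi4E.
by have [-> -> ->] := H p; rewrite !mul1n !(addnAC _ p).
Qed.
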